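(* Let $n$, $k$ and $d_{1},d_{2},\ldots,d_{n}$ be integers with $1\leq k\leq n-1$ and $2\leq d_{1}\leq d_{2}\leq\cdots\leq d_{n}\leq n-1$. Let $G$ be a $k$-connected simple graph with vertex set $V(G)=\{w_{1},w_{2},\ldots,w_{n}\}$ such that \[ d(u)+d(v)\geq n-1-\sum_{j=1}^{k}(d_{j}-2) \] for any two non-adjacent vertices $u$ and $v$ of $G$, where $d(x)$ denotes the degree of $x$ in $G$. Then $G$ has a spanning tree $T$ with at most $2+\sum_{j=1}^{k}(d_{j}-2)$ leaves and such that $d_{T}(w_{j})\leq d_{j}$ for $j=1,2,\ldots,n$.
   Context: A leaf of a tree $T$ is a vertex of degree one in $T$. For a subgraph $T$ of $G$, $d_T(x)$ denotes the degree of the vertex $x$ in $T$. *)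

(* Defs.v *)
From mathcomp Require Import all_boot all_order all_algebra.

Set Implicit Arguments.
Unset Strict Implicit.
Unset Printing Implicit Defensive.

Record sgraph (V : finType) := SGraph {
  adj :> rel V;
  adj_sym : symmetric adj;
  adj_irr : irreflexive adj }.

Section Graphs.
Variable V : finType.
Implicit Types (G T : sgraph V) (S : {set V}).

Definition degree G (x : V) : nat := #|[set y | G x y]|.

(* Any two vertices outside S are joined by a path avoiding S. *)
Definition connected_minus G S : Prop :=
  forall x y : V, x \notin S -> y \notin S ->
    connect [rel a b | [&& a \notin S, b \notin S & G a b]] x y.

Definition connected G : Prop := 0 < #|V| /\ connected_minus G set0.

(* The standard convention: more than k vertices, and deleting fewer than k
   vertices never disconnects; so the complete graph on n vertices is
   (n-1)-connected. *)
Definition k_connected (k : nat) G : Prop :=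
  k < #|V| /\ forall S, #|S| < k -> connected_minus G S.

(* A cycle is a duplicate-free cyclic sequence of at least three vertices. *)
Definition acyclic G : Prop := forall c : seq V, 2 < size c -> ~ ucycle G c.

Definition is_tree T : Prop := connected T /\ acyclic T.

(* T has the whole of V as its vertex set, so it spans G by construction. *)
Definition spanning_tree G T : Prop := subrel T G /\ is_tree T.

Definition leaves T : {set V} := [set x | degree T x == 1].

End Graphs.

(* Main.v *)
Require Import Defs.
From mathcomp Require Import all_boot all_order all_algebra.
From mathcomp Require Import zify.

Set Implicit Arguments.
Unset Strict Implicit.
Unset Printing Implicit Defensive.

(** Put [s = \sum_(j < k) (d_j - 2)].  By the crossing-edge argument of Ore, a
    path on [p] vertices with [p + s < n] can be lengthened: otherwise its end
    vertices are non-adjacent and have degree sum at most [p - 1].  So some path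
    [P] misses at most [s] vertices.  Starting from [P], attach the remaining
    vertices one by one as pendant vertices, respecting the degree bounds; each
    of them raises the excess [\sum_x (d_T(x) - 2)^+] by at most one, so the
    excess stays at most [s], and the number of leaves at most [2 + s].  If the
    process is stuck at a tree on [U], then the vertices of [U] with a neighbour
    outside [U] have reached their bounds; they separate a leaf of the tree from
    the rest, so there are at least [k] of them, and the excess is already [s],
    which leaves no vertex to attach. *)

(** * Sums over index sets and counting along sequences *)

(** Exchange argument through the threshold [m], the value of [f] at index [k]: indices in [A] but
    not in [S] carry at most [m], those in [S] but not in [A] at least [m], and the latter are no
    fewer. *)
Lemma sum_initial_le n k (f : 'I_n -> nat) (S : {set 'I_n}) :
    {homo f : i j / i <= j} -> k < n -> k <= #|S| ->
  \sum_(j < n | j < k) f j <= \sum_(j in S) f j.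
Proof.
move=> fmono ltkn leS; set A := [set j : 'I_n | j < k].
have cardA : #|A| <= k.
  rewrite cardsE cardE -(size_map val) -[X in _ <= X](size_iota 0 k).
  apply: uniq_leq_size; first by rewrite (map_inj_uniq val_inj) enum_uniq.
  by move=> _ /mapP[j + ->]; rewrite mem_enum mem_iota.
rewrite (eq_bigl [in A]) => [|j]; last by rewrite inE.
rewrite (big_setID S) [X in _ <= X](big_setID A) /= setIC leq_add2l.
pose m := f (Ordinal ltkn).
have leAS : #|A :\: S| <= #|S :\: A|.
  by rewrite -(leq_add2l #|A :&: S|) cardsID setIC cardsID (leq_trans cardA).
apply: (@leq_trans (#|A :\: S| * m)).
  rewrite -sum_nat_const; apply: leq_sum => j; rewrite !inE => /andP[_ ltjk].
  exact/fmono/ltnW.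
apply: (@leq_trans (#|S :\: A| * m)); first by rewrite leq_mul2r leAS orbT.
rewrite -sum_nat_const; apply: leq_sum => j; rewrite !inE -leqNgt => /andP[lekj _].
exact: fmono.
Qed.

Lemma sum_eq_nat1 (T : finType) (t : T) : \sum_z (z == t : nat) = 1.
Proof. by rewrite (bigD1 t) //= eqxx big1 // => z /negPf->. Qed.

Lemma connect_exit (T : finType) (e : rel T) (A : {set T}) x z :
    connect e x z -> x \in A -> z \notin A ->
  exists a b, [/\ a \in A, b \notin A & e a b].
Proof.
move=> /connectP[p + ->]; elim: p x => [|y p IHp] x /=; first by move=> _ ->.
case/andP=> exy pth xA zA; case: (boolP (y \in A)) => [yA|yA]; first exact: IHp pth yA zA.
by exists x, y.
Qed.

(** Pigeonhole on the positions of [p]: [belast x p] lists the predecessors of the entries of [p],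
    so when the two counts together exceed [size p], some entry satisfies [a] while its predecessor
    satisfies [b]. *)
Lemma count_crossing (T : Type) (a b : pred T) x p :
    size p < count a p + count b (belast x p) ->
  exists p1 y p2, [/\ p = p1 ++ y :: p2, a y & b (last x p1)].
Proof.
elim: p x => [|y p IHp] x //=.
case: (boolP (a y && b x)) => [/andP[ay bx] _|nab H]; first by exists [::], y, p.
have [|p1 [z [p2 [-> az bl]]]] := IHp y; last by exists (y :: p1), z, p2.
by move: nab H; case: (a y); case: (b x) => //=; lia.
Qed.

Section Graph.
Variables (V : finType) (G : sgraph V).
Implicit Types (T : sgraph V) (U : {set V}).

(** * Lengthening paths *)

(** The cycle follows [p1], jumps from its end to the last vertex of the path, runs backwards to
    [y], and closes with the edge between [y] and [x]. *)
Lemma crossing_cycle x p1 y p2 :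
    path G x (p1 ++ y :: p2) -> G x y -> G (last y p2) (last x p1) ->
  cycle G (x :: p1 ++ rev (y :: p2)).
Proof.
rewrite cat_path /= => /and3P[pth1 _ pth2] Gxy Glast.
rewrite rcons_cat cat_path pth1 lastI rev_rcons rcons_cons /= adj_sym Glast /=.
rewrite -rev_cons -[x :: _]/(belast x (y :: p2)) -[last y p2]/(last x (y :: p2)).
rewrite rev_path (@eq_path _ _ G) => [|u v /=]; last exact: adj_sym.
by rewrite /= Gxy.
Qed.

(** Connectivity gives an edge leaving the cycle; opening the cycle at the inner end of this edge
    yields a path with one more vertex. A single edge counts as a cycle of length two here. *)
Lemma cycle_extend c :
    connected_minus G set0 -> cycle G c -> uniq c -> 0 < size c < #|V| ->
  exists x p, [/\ path G x p, uniq (x :: p) & size p = size c].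
Proof.
case: c => // c0 c conG cycc uc /andP[_ ltc].
have [z zc] : exists z, z \notin c0 :: c.
  apply/existsP; rewrite -negb_forall; apply/negP=> /forallP allc.
  move: ltc; rewrite ltnNge -(card_uniqP uc) => /negP; apply.
  by apply/subset_leq_card/subsetP=> t _; apply: allc.
have := @connect_exit _ _ [set u in c0 :: c] _ _ (conG c0 z _ _).
rewrite !in_set0 => /(_ isT isT).
rewrite !inE eqxx -in_cons => /(_ isT zc) [a [b [+ +]]].
rewrite !inE -!in_cons => ac bc /and3P[_ _ Gab].
case: (rot_to ac) => i q Eq; exists b, (a :: q).
split; last by rewrite -Eq size_rot.
  have : cycle G (a :: q) by rewrite -Eq rot_cycle.
  by rewrite /= rcons_path [G b a]adj_sym Gab => /andP[].
by rewrite cons_uniq -Eq mem_rot bc rot_uniq.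
Qed.

Lemma degree_count x (s : seq V) :
  (forall y, G x y -> y \in s) -> degree G x <= count (G x) s.
Proof.
move=> Gs; rewrite -size_filter; apply: leq_trans (card_size _).
by apply/subset_leq_card/subsetP=> y; rewrite inE mem_filter => Gxy; rewrite Gxy Gs.
Qed.

Lemma path_extend s x p :
    connected_minus G set0 ->
    (forall u v, u != v -> ~~ G u v -> #|V| <= (degree G u + degree G v + s).+1) ->
    path G x p -> uniq (x :: p) -> (size p).+1 + s < #|V| ->
  exists x' p', [/\ path G x' p', uniq (x' :: p') & size p' = (size p).+1].
Proof.
move=> conG ore pth up lts.
have ltp : 0 < (size p).+1 < #|V| by lia.
case: (boolP [forall y, G x y ==> (y \in x :: p)]) => [|/forallPn[y]]; last first.
  rewrite negb_imply => /andP[Gxy yp].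
  by exists y, (x :: p); split=> //; [rewrite /= adj_sym Gxy | rewrite cons_uniq yp].
move/forallP=> Nx; set v := last x p.
case: (boolP [forall y, G v y ==> (y \in x :: p)]) => [|/forallPn[y]]; last first.
  rewrite negb_imply => /andP[Gvy yp].
  exists x, (rcons p y); split; rewrite ?size_rcons ?rcons_path ?pth //.
  by rewrite -rcons_cons rcons_uniq yp.
move/forallP=> Nv.
case: (boolP (G x v)) => [Gxv|nGxv].
  apply: (@cycle_extend (x :: p)) => //=.
  by rewrite rcons_path pth -/v adj_sym.
(* The degree condition concerns distinct vertices, so the one-vertex path is treated apart:
   connectivity gives [x] a neighbour off the path, against [Nx]. *)
have [xv|neq_xv] := eqVneq x v.
  have p0 : p = [::].
    by move: up xv; rewrite /v; case: (p) => [|y q] //= + E; rewrite {1}E mem_last.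
  have [z zx] : exists z, z != x.
    apply/existsP; rewrite -negb_forall; apply/negP=> /forallP allc.
    have: #|V| <= #|[set x]| by apply/subset_leq_card/subsetP=> z _; rewrite inE.
    by rewrite cards1; lia.
  have := @connect_exit _ _ [set x] _ _ (conG x z _ _).
  rewrite !in_set0 !inE eqxx => /(_ isT isT isT zx) [a [b [+ +]]].
  rewrite !inE => /eqP-> bx /and3P[_ _ Gxb].
  by have := Nx b; rewrite p0 inE Gxb (negPf bx).
have dx : degree G x <= count (G x) p.
  apply: leq_trans (degree_count (s := x :: p) _) _ => [y|]; first exact/implyP.
  by rewrite /= adj_irr.
have dv : degree G v <= count (G v) (belast x p).
  apply: leq_trans (degree_count (s := x :: p) _) _ => [y|]; first exact/implyP.
  by rewrite lastI -cats1 count_cat /= adj_irr !addn0.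
have [|p1 [y [p2 [Ep Gxy Gvl]]]] := @count_crossing _ (G x) (G v) x p.
  by have := ore _ _ neq_xv nGxv; lia.
have Ev : last y p2 = v by rewrite /v Ep last_cat.
have Pc : perm_eq (x :: p1 ++ rev (y :: p2)) (x :: p).
  by rewrite Ep perm_cons perm_cat2l perm_rev.
have [||||x' [p' [? ? sz]]] := @cycle_extend (x :: p1 ++ rev (y :: p2)).
- exact: conG.
- by apply: crossing_cycle; rewrite -?Ep ?Ev.
- by rewrite (perm_uniq Pc).
- by rewrite (perm_size Pc).
by exists x', p'; rewrite sz (perm_size Pc).
Qed.

Lemma long_path s :
    0 < #|V| -> connected_minus G set0 ->
    (forall u v, u != v -> ~~ G u v -> #|V| <= (degree G u + degree G v + s).+1) ->
  exists x p, [/\ path G x p, uniq (x :: p) & #|V| <= (size p).+1 + s].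
Proof.
move=> /card_gt0P[x0 _] conG ore.
suff H m x p : #|V| - (size p).+1 <= m -> path G x p -> uniq (x :: p) ->
    exists x p, [/\ path G x p, uniq (x :: p) & #|V| <= (size p).+1 + s].
  exact: (H _ x0 [::] (leqnn _)).
elim: m x p => [|m IHm] x p lem pth up; first by exists x, p; split=> //; lia.
have [lts|ges] := ltnP ((size p).+1 + s) #|V|; last by exists x, p.
have [x' [p' [pth' up' sz]]] := path_extend conG ore pth up lts.
by apply: (IHm x' p') => //; lia.
Qed.

(* The sum condition says that [T] has [#|U| - 1] edges. *)
Record tree_on U T : Prop := TreeOn {
  tree_on_sub : subrel T G;
  tree_on_dom : forall x y, T x y -> x \in U;
  tree_on_conn : {in U &, forall x y, connect T x y};
  tree_on_acyclic : acyclic T;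
  tree_on_degree : \sum_x degree T x + 2 = 2 * #|U| }.

(** * Attaching a pendant vertex to a tree *)

Section AddEdge.
Variables (T : sgraph V) (x y : V) (neq_xy : x != y).

Definition add_edge_rel : rel V :=
  fun a b => [|| T a b, (a == x) && (b == y) | (a == y) && (b == x)].

Lemma add_edge_sym : symmetric add_edge_rel.
Proof.
by move=> a b; rewrite /add_edge_rel adj_sym; do !case: eqP; rewrite ?orbT ?orbF.
Qed.

Lemma add_edge_irr : irreflexive add_edge_rel.
Proof.
move=> a; rewrite /add_edge_rel adj_irr.
by case: (eqVneq a x) => [->|] /=; rewrite ?(negPf neq_xy) ?andbF.
Qed.

Definition add_edge : sgraph V := SGraph add_edge_sym add_edge_irr.
End AddEdge.

Section AddPendant.
Variables (U : {set V}) (T : sgraph V) (x y : V) (neq_xy : x != y).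
Hypotheses (treeT : tree_on U T) (xU : x \in U) (yU : y \notin U) (Gxy : G x y).
Let T' := add_edge T neq_xy.

Lemma pendant_outside a : T y a = false.
Proof. by apply: contraNF yU; apply: (tree_on_dom treeT). Qed.

Lemma degree_outside : degree T y = 0.
Proof.
by apply/eqP; rewrite cards_eq0; apply/eqP/setP=> b; rewrite !inE pendant_outside.
Qed.

Lemma degree_add_pendant z : degree T' z = degree T z + (z == x) + (z == y).
Proof.
rewrite /degree; have [->|zx] := eqVneq z x.
  have -> : [set b | T' x b] = y |: [set b | T x b].
    apply/setP=> b; rewrite !inE /= /add_edge_rel eqxx (negPf neq_xy) /= orbF.
    by rewrite orbC.
  by rewrite cardsU1 inE adj_sym pendant_outside (negPf neq_xy) addnC addn0.
have [->|zy] := eqVneq z y.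
  have -> : [set b | T' y b] = [set x].
    apply/setP=> b.
    by rewrite !inE /= /add_edge_rel pendant_outside eqxx eq_sym (negPf neq_xy).
  by rewrite cards1 -/(degree T y) degree_outside.
rewrite !addn0; congr #|pred_of_set _|; apply/setP=> b.
by rewrite !inE /= /add_edge_rel (negPf zx) (negPf zy) /= orbF.
Qed.

(** A cycle avoiding [y] already lies in [T]. On a cycle through [y], the successor and the
    predecessor of [y] are distinct, yet both must be [x], the only neighbour of [y]. *)
Lemma acyclic_add_pendant : acyclic T'.
Proof.
move=> c sz /andP[cycc uc]; have [yc|yc] := boolP (y \in c); last first.
  apply: (tree_on_acyclic treeT sz); rewrite /ucycle uc andbT.
  apply: (@sub_in_cycle _ (predC1 y) T' T) cycc => [a b|].
    by rewrite !inE /= /add_edge_rel => /negPf-> /negPf->; rewrite andbF !orbF.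
  by apply/allP=> a ac /=; apply: contraNneq yc => <-.
case: (rot_to yc) => i q Eq.
have T'y a : T' y a -> a = x.
  rewrite /= /add_edge_rel pendant_outside eqxx [y == x]eq_sym (negPf neq_xy).
  by move/eqP.
have cq : cycle T' (y :: q) by rewrite -Eq rot_cycle.
have uq : uniq (y :: q) by rewrite -Eq rot_uniq.
have: 2 < size (y :: q) by rewrite -Eq size_rot.
case: q {Eq} cq uq => [|a [|b q]] // + + _.
rewrite [cycle _ _]/= rcons_path => /and4P[/T'y-> _ _].
rewrite add_edge_sym => /T'y E; rewrite !cons_uniq => /and3P[_ + _].
by rewrite -{1}E mem_last.
Qed.

Lemma tree_on_add_pendant : tree_on (y |: U) T'.
Proof.
split.
- move=> a b /=; rewrite /add_edge_rel.
  case/or3P=> [/(tree_on_sub treeT) //|/andP[/eqP-> /eqP->] //|/andP[/eqP-> /eqP->]].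
  by rewrite adj_sym.
- move=> a b /=; rewrite /add_edge_rel !inE.
  case/or3P=> [/(tree_on_dom treeT)->|/andP[/eqP-> _]|/andP[-> _] //].
    by rewrite orbT.
  by rewrite xU orbT.
- have T'sym : connect_sym T' := sym_connect_sym (adj_sym T').
  suff H a : a \in y |: U -> connect T' x a.
    move=> a b aU bU; apply: connect_trans (H b bU).
    by rewrite T'sym H.
  case/setU1P=> [->|aU].
    by apply: connect1; rewrite /= /add_edge_rel !eqxx orbT.
  apply: connect_sub (tree_on_conn treeT xU aU) => u v Tuv.
  by apply: connect1; rewrite /= /add_edge_rel Tuv.
- exact: acyclic_add_pendant.
- rewrite (eq_bigr _ (fun z _ => degree_add_pendant z)) !big_split /=.
  rewrite !sum_eq_nat1 cardsU1 yU; have := tree_on_degree treeT; lia.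
Qed.

End AddPendant.

Definition empty_graph : sgraph V :=
  @SGraph V (fun _ _ => false) (fun _ _ => erefl) (fun _ => erefl).

Lemma degree_empty_graph x : degree empty_graph x = 0.
Proof. by apply/eqP; rewrite cards_eq0; apply/eqP/setP=> y; rewrite !inE. Qed.

Lemma tree_on1 x : tree_on [set x] empty_graph.
Proof.
split=> //.
- by move=> a b /set1P-> /set1P->.
- by case=> [|a [|b c]].
- by rewrite big1 ?cards1 // => z _; rewrite degree_empty_graph.
Qed.

(** The bound on the degree of the first vertex carries the induction: the next vertex is attached
    there, raising that degree to at most two. *)
Lemma tree_on_path x p :
    path G x p -> uniq (x :: p) ->
  exists T, [/\ tree_on [set z in x :: p] T, degree T x <= 1
              & forall z, degree T z <= 2].
Proof.
elim: p x => [|y p IHp] x.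
  move=> _ _; exists empty_graph; split=> [||z]; rewrite ?degree_empty_graph //.
  have -> : [set z in [:: x]] = [set x] by apply/setP=> z; rewrite !inE.
  exact: tree_on1.
rewrite [path _ _ _]/= cons_uniq => /andP[Gxy pth] /andP[xp up].
have [T [treeT degy deg2]] := IHp y pth up.
have neq_yx : y != x by apply: contraNneq xp => <-; rewrite mem_head.
have yU : y \in [set z in y :: p] by rewrite inE mem_head.
have xU : x \notin [set z in y :: p] by rewrite inE.
have Gyx : G y x by rewrite adj_sym.
have degT' := degree_add_pendant neq_yx treeT xU.
have degx : degree T x = 0 := degree_outside treeT xU.
exists (add_edge T neq_yx); split.
- have -> : [set z in x :: y :: p] = x |: [set z in y :: p].
    by apply/setP=> z; rewrite !inE.
  exact: tree_on_add_pendant.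
- by rewrite degT' degx eqxx eq_sym (negPf neq_yx).
move=> z; rewrite degT'; have := deg2 z.
have [->|zy] := eqVneq z y; first by rewrite (negPf neq_yx); lia.
by have [->|zx] := eqVneq z x; rewrite ?degx; lia.
Qed.

(** Sum over all vertices the inequality saying that a degree, plus one if it equals one, is at most
    two plus its truncated excess over two. *)
Lemma leaves_le_excess T :
    \sum_x degree T x + 2 = 2 * #|V| ->
  #|leaves T| <= 2 + \sum_x (degree T x - 2).
Proof.
move=> degT.
have -> : #|leaves T| = \sum_x (degree T x == 1 : nat).
  by rewrite -sum1_card big_mkcond /=; apply: eq_bigr => x _; rewrite inE; case: eqP.
have: \sum_x (degree T x + (degree T x == 1)) <= \sum_x (2 + (degree T x - 2)).
  by apply: leq_sum => x _; case: eqP; lia.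
have sum2 : \sum_(x : V) 2 = 2 * #|V| by rewrite sum_nat_const mulnC.
by rewrite !big_split /= sum2; lia.
Qed.

(** * Growing a tree under degree bounds *)

Section Grow.
Variables (k s : nat) (cap : V -> nat).
Hypotheses (cap_ge2 : forall x, 2 <= cap x) (hG : k_connected k G)
  (cap_sum : forall S : {set V}, k <= #|S| -> s <= \sum_(x in S) (cap x - 2)).

Lemma attachable U T :
    tree_on U T -> \sum_x (degree T x - 2) < s -> 0 < #|U| < #|V| ->
  exists x y, [/\ x \in U, y \notin U, G x y & degree T x < cap x].
Proof.
move=> treeT exT /andP[U0 ltU].
pose S := [set x in U | [exists y, (y \notin U) && G x y]].
suff /existsP[x /andP[]] : [exists x, (x \in S) && (degree T x < cap x)].
  by rewrite inE => /andP[xU /existsP[y /andP[yU Gxy]]] ltx; exists x, y.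
(* By contraposition: if every vertex of [S] has reached its bound, the excess is at least [s]. *)
apply: contraLR exT => /existsPn full; rewrite -leqNgt.
have sat x : x \in S -> cap x <= degree T x.
  by move=> xS; move: (full x); rewrite xS /= -leqNgt.
have leS : k <= #|S|.
  rewrite leqNgt; apply/negP=> /(hG.2 S) conS.
  (* The degrees sum to [2 * #|U| - 2], so some vertex of [U] has degree below two. Bounds are at
     least two, so it is not saturated and lies outside [S]. *)
  have /existsP[z /andP[zU degz]] : [exists z, (z \in U) && (degree T z < 2)].
    rewrite -[X in is_true X]negbK; apply/negP=> /existsPn noz.
    have: \sum_(z in U) 2 <= \sum_(z in U) degree T z.
      by apply: leq_sum => z zU; move: (noz z); rewrite zU /= -leqNgt.
    have: \sum_(z in U) degree T z <= \sum_z degree T z.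
      by rewrite [X in _ <= X](bigID [in U]) leq_addr.
    by rewrite sum_nat_const; have := tree_on_degree treeT; lia.
  have [t tU] : exists t, t \notin U.
    apply/existsP; rewrite -negb_forall; apply/negP=> /forallP allU.
    by move: ltU; rewrite ltnNge -cardsT subset_leq_card //; apply/subsetP=> t _.
  have zS : z \notin S by apply/negP=> /sat; have := cap_ge2 z; lia.
  have tS : t \notin S by rewrite inE (negPf tU).
  (* A walk from [z] to [t] avoiding [S] must leave [U], but the inner end of the edge by which it
     leaves belongs to [S]. *)
  have [a [b [aU bU]]] := connect_exit (conS z t zS tS) zU tU.
  rewrite /= => /and3P[+ _ Gab]; rewrite inE aU /= => /existsPn/(_ b).
  by rewrite bU Gab.
apply: leq_trans (cap_sum leS) _.
rewrite [X in _ <= X](bigID [in S]) /=; apply: leq_trans (leq_addr _ _).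
by apply: leq_sum => x xS; rewrite leq_sub2r ?sat.
Qed.

(** Each attachment adds one to [#|U|] and at most one to the excess, so excess plus [p] stays at
    most [#|U|]. While [#|U| < #|V|], this keeps the excess below [s], as [attachable] requires; at
    the end it gives the bound [s]. *)
Lemma tree_grow p U T :
    tree_on U T -> 0 < #|U| -> (forall x, degree T x <= cap x) ->
    \sum_x (degree T x - 2) + p <= #|U| -> #|V| <= p + s ->
  exists T, [/\ tree_on setT T, forall x, degree T x <= cap x
              & \sum_x (degree T x - 2) <= s].
Proof.
have [m] := ubnP (#|V| - #|U|); elim: m U T => // m IHm U T.
rewrite ltnS => lem treeT U0 degT exT leV.
have leU : #|U| <= #|V| := max_card _.
have [ltU|geU] := ltnP #|U| #|V|; last first.
  have EU : U = setT by apply/eqP; rewrite eqEcard subsetT cardsT.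
  by exists T; split=> //; [rewrite -EU | lia].
have [||x [y [xU yU Gxy ltx]]] := attachable treeT.
- by lia.
- by rewrite U0.
have neq_xy : x != y by apply: contraNneq yU => <-.
have degT' := degree_add_pendant neq_xy treeT yU.
have degy : degree T y = 0 := degree_outside treeT yU.
have cardU : #|y |: U| = #|U|.+1 by rewrite cardsU1 yU.
apply: (IHm (y |: U) (add_edge T neq_xy)); rewrite ?cardU //.
- by lia.
- exact: tree_on_add_pendant.
- move=> z; rewrite degT'; have := degT z; have := cap_ge2 z.
  have [->|zx] := eqVneq z x; first by rewrite (negPf neq_xy); lia.
  by have [->|zy] := eqVneq z y; rewrite ?degy; lia.
(* The new vertex [y] has degree one and contributes no excess; only [x] can gain one. *)
have: \sum_z (degree (add_edge T neq_xy) z - 2)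
      <= \sum_z ((degree T z - 2) + (z == x)).
  apply: leq_sum => z _; rewrite degT'.
  have [->|zx] := eqVneq z x; first by rewrite (negPf neq_xy); lia.
  by have [->|zy] := eqVneq z y; rewrite ?degy; lia.
by rewrite big_split /= sum_eq_nat1; lia.
Qed.

End Grow.

Lemma tree_on_spanning T : 0 < #|V| -> tree_on setT T -> spanning_tree G T.
Proof.
move=> V0 treeT; split; first exact: tree_on_sub treeT.
split; last exact: tree_on_acyclic treeT.
split=> // x y _ _; have := tree_on_conn treeT (in_setT x) (in_setT y).
by apply: connect_sub => a b Tab; apply: connect1; rewrite /= !in_set0.
Qed.

End Graph.

(* The paper's w_j and d_j are [w i] and [d i] with [i = j - 1]. *)
Theorem theorem2 (n k : nat) (d : 'I_n -> nat)
  (hk : 1 <= k <= n - 1)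
  (hd : forall i : 'I_n, 2 <= d i <= n - 1)
  (hmono : forall i j : 'I_n, i <= j -> d i <= d j)
  (V : finType) (w : 'I_n -> V) (hw : bijective w)
  (G : sgraph V) (hG : k_connected k G)
  (hdeg : forall u v : V, u != v -> ~~ G u v ->
    (n%:Z - 1 - \sum_(j < n | (j < k)%N) ((d j)%:Z - 2)
       <= (degree G u)%:Z + (degree G v)%:Z)%R) :
  exists T : sgraph V,
    [/\ spanning_tree G T,
        (#|leaves T|%:Z <= 2 + \sum_(j < n | (j < k)%N) ((d j)%:Z - 2))%R
      & forall j : 'I_n, degree T (w j) <= d j].
Proof.
have cardV : #|V| = n by rewrite -(bij_eq_card hw) card_ord.
pose s := \sum_(j < n | j < k) (d j - 2).
(* Since each [d j] is at least two, truncated subtraction agrees with the integer one. *)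
have Es : (\sum_(j < n | (j < k)%N) ((d j)%:Z - 2) = s%:Z)%R.
  rewrite /s (big_morph Posz PoszD (erefl _)).
  by apply: eq_bigr => j _; have := hd j; lia.
rewrite Es in hdeg *.
have [g wK gK] := hw; pose cap x := d (g x).
have cap_ge2 x : 2 <= cap x by have /andP[] := hd (g x).
(* The vertices of [S] correspond to at least [k] indices, and the first [k] indices have the
   smallest bounds. *)
have cap_sum (S : {set V}) : k <= #|S| -> s <= \sum_(x in S) (cap x - 2).
  have ginj := can_inj gK.
  rewrite -(card_imset _ ginj) => leS.
  apply: leq_trans (sum_initial_le (f := fun j => d j - 2) _ _ leS) _.
  - by move=> i j leij; apply/leq_sub2r/hmono.
  - by lia.
  by rewrite big_imset //= => a b _ _; apply: ginj.
have V0 : 0 < #|V| by rewrite cardV; lia.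
(* As [k] is at least one, deleting the empty set is allowed. *)
have conG : connected_minus G set0 by apply: hG.2; rewrite cards0; lia.
have [|x [p [pth up lep]]] := @long_path _ G s V0 conG.
  by move=> u v neq nG; have := hdeg u v neq nG; rewrite cardV; lia.
have [T [treeT _ deg2]] := tree_on_path pth up.
have cardU : #|[set z in x :: p]| = (size p).+1 by rewrite cardsE (card_uniqP up).
have [||||T' [treeT' degT' exT']] :=
  tree_grow cap_ge2 hG cap_sum (p := (size p).+1) treeT.
- by rewrite cardU.
- by move=> z; apply: leq_trans (deg2 z) (cap_ge2 z).
(* The initial path has no vertex of degree above two, hence excess zero. *)
- by rewrite big1 ?cardU // => z _; apply/eqP; rewrite subn_eq0.
- exact: lep.
exists T'; split.
- exact: tree_on_spanning.
- have := @leaves_le_excess _ T'; rewrite -cardsT => /(_ (tree_on_degree treeT')).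
  by lia.
by move=> j; have := degT' (w j); rewrite /cap wK.
Qed.
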